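(* Let $G$ be a pseudocompact Tychonoff semitopological group with multiplication $\mathfrak{m}: G\times G\to G$, $(g,h)\mapsto gh$. The following conditions are equivalent: (1) $G$ is a topological group; (2) the multiplication $\mathfrak{m}$ extends to a separately continuous map $\hat{\mathfrak{m}}:\beta G\times\beta G\to\beta G$; (3) the multiplication $\mathfrak{m}$ extends to a separately continuous map $\hat{\mathfrak{m}}:\beta G\times\beta G\to\beta G$ and $(\beta G,\hat{\mathfrak{m}})$ is a topological group; (4) the multiplication $\mathfrak{m}$ is quasi-continuous.
   Context: A space is pseudocompact if every continuous real-valued function on it is bounded. $\beta G$ is the Stone–Čech compactification of the space $G$, with $G\subset\beta G$. A semitopological group is a group with a topology such that multiplication is separately continuous (continuous in each variable when the other is fixed). A map $f: Z\to Y$ between spaces is quasi-continuous if for every $z\in Z$, every neighborhood $O$ of $f(z)$ and every neighborhood $W$ of $z$ there is a non-empty open $U\subset W$ with $f(U)\subset O$. *)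

(* Defs.v *)
From HB Require Import structures.
From mathcomp Require Import all_boot all_order all_algebra.
From mathcomp Require Import all_classical all_reals all_analysis.

Set Implicit Arguments.
Unset Strict Implicit.
Unset Printing Implicit Defensive.

Import Order.TTheory GRing.Theory Num.Theory.
Import numFieldNormedType.Exports.

Local Open Scope classical_set_scope.
Local Open Scope ring_scope.

Definition separately_continuous (X Y Z : topologicalType) (f : X -> Y -> Z) :=
  (forall x, continuous (f x)) /\ (forall y, continuous (f ^~ y)).

Definition quasi_continuous (Z Y : topologicalType) (f : Z -> Y) :=
  forall (z : Z) (O : set Y) (W : set Z), nbhs (f z) O -> nbhs z W ->
    exists U : set Z, [/\ open U, U !=set0, U `<=` W & f @` U `<=` O].

Definition tychonoff_space (X : topologicalType) :=
  completely_regular_space X /\ hausdorff_space X.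

Definition pseudocompact (R : realType) (X : topologicalType) :=
  forall f : X -> R, continuous f -> [bounded f x | x in [set: X]].

HB.mixin Record isSemitopologicalGroup G of Topological G & Group G := {
  mulg_separately_continuous : separately_continuous (@monoid.mul G)
}.

#[short(type="semitopologicalGroupType")]
HB.structure Definition SemitopologicalGroup :=
  {G of Topological G & Group G & isSemitopologicalGroup G}.

Definition is_topological_group (T : topologicalType)
    (mul : T -> T -> T) (one : T) (inv : T -> T) :=
  [/\ associative mul, left_id one mul, left_inverse one inv mul,
      continuous (fun p : T * T => mul p.1 p.2) & continuous inv].

(** The Stone-Cech compactification of [X] is the closure of the image of [X]
    in the product of the intervals [0, 1] indexed by the continuous functions
    from [X] to [0, 1]; the closure is taken in the larger product of copies of
    [R], in which that cube is closed. *)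
Section stone_cech.
Variables (R : realType) (X : topologicalType).

Definition unit_functions : set (X -> R) :=
  [set f : X -> R | continuous f /\ forall x, 0 <= f x <= 1].

Definition unit_eval : X -> prod_topology (fun _ : unit_functions => R) :=
  join_product (fun f : unit_functions => set_val f).

Definition stone_cech : Type := set_type (closure (range unit_eval)).

HB.instance Definition _ :=
  Topological.copy stone_cech (set_type (closure (range unit_eval))).

Definition to_stone_cech (x : X) : stone_cech :=
  exist _ (unit_eval x) (mem_set (subset_closure (imageT unit_eval x))).

End stone_cech.
Arguments unit_functions : clear implicits.
Arguments unit_eval : clear implicits.
Arguments to_stone_cech : clear implicits.

Definition extends_to_stone_cech (R : realType) (X : topologicalType)
    (m : X -> X -> X)
    (m' : stone_cech R X -> stone_cech R X -> stone_cech R X) :=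
  forall x y,
    m' (to_stone_cech R X x) (to_stone_cech R X y) = to_stone_cech R X (m x y).

(** The lemmas below check that [stone_cech R X] is a compact Hausdorff space
    in which a Tychonoff space [X] is densely embedded, with the universal
    extension property. *)
Section stone_cech_theory.
Import ArrowAsProduct.
Variables (R : realType).
Implicit Types X K : topologicalType.

Lemma cvg_unit_eval X T (F : set_system T) {FF : Filter F}
    (g : T -> prod_topology (fun _ : unit_functions R X => R)) p :
  (forall i, (fun t => g t i) @ F --> p i) -> g @ F --> p.
Proof.
move=> gp; apply/cvg_sup => i U [/= _ [[V oV <-] /= Vp] VU].
by apply: filterS VU _; apply: (gp i); exact: open_nbhs_nbhs.
Qed.

Lemma continuous_to_stone_cech X : continuous (to_stone_cech R X).
Proof.
move=> x; have c : unit_eval R X @ x --> unit_eval R X x.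
  by apply: cvg_unit_eval => i; have := set_valP i => -[+ _]; exact.
move=> U [/= _ [[V oV <-] /= Vx] VU].
by apply: filterS VU _; apply: c; exact: open_nbhs_nbhs.
Qed.

Lemma dense_to_stone_cech X : dense (range (to_stone_cech R X)).
Proof.
move=> U [p Up] [V oV VU].
have [_ [[x _ <-] Vx]] : range (unit_eval R X) `&` V !=set0.
  apply: (set_mem (valP p)); apply: open_nbhs_nbhs; split=> //.
  by move: Up; rewrite -VU.
by exists (to_stone_cech R X x); split; [rewrite -VU|exists x].
Qed.

Lemma hausdorff_stone_cech X : hausdorff_space (stone_cech R X).
Proof.
move=> p q pq; apply/val_inj/(@hausdorff_product _ _ (fun=> @norm_hausdorff R R)).
move=> A B Ap Bq.
have [||z [Az Bz]] := pq (val @^-1` A) (val @^-1` B); last by exists (val z).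
- exact: (@initial_continuous _ _ (set_val : stone_cech R X -> _)).
- exact: (@initial_continuous _ _ (set_val : stone_cech R X -> _)).
Qed.

Lemma compact_set_type (T : topologicalType) (A : set T) :
  compact A -> compact [set: A].
Proof.
move=> cA F PF _.
have FF : ProperFilter (set_val @ F) by exact: fmap_proper_filter.
have [|p [Ap clp]] := cA (set_val @ F) FF.
  by rewrite nbhs_simpl /=; apply: filterE => x /=; have := set_valP x.
exists (exist _ p (mem_set Ap)); split=> // U V FU [_ [[W oW <-] /= Wp] WV].
have FU' : (set_val @ F) (set_val @` U).
  by rewrite nbhs_simpl /=; apply: filterS FU => u Uu; exists u.
have [|_ [[u Uu <-] Wu]] := clp _ W FU'; first exact: open_nbhs_nbhs.
by exists u; split=> //; exact: WV.
Qed.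

Lemma compact_stone_cech X : compact [set: stone_cech R X].
Proof.
pose C := [set f : forall _ : unit_functions R X, R |
  forall i, [set` `[0 : R, 1]] (f i)].
have cC : compact C.
  apply: (@tychonoff _ (fun=> R) (fun=> [set` `[0 : R, 1]])) => i.
  exact: segment_compact.
have clC : closed C.
  by apply: compact_closed cC; apply: hausdorff_product => _; exact: norm_hausdorff.
apply/compact_set_type/(subclosed_compact _ cC); first exact: closed_closure.
rewrite [C](closure_id _).1//; apply: closureS => _ [x _ <-] i /=.
by have [_ /(_ x)] := set_valP i; rewrite in_itv.
Qed.

Lemma tychonoff_unit_eval X : tychonoff_space X ->
  separate_points_from_closed (fun i : unit_functions R X => set_val i).
Proof.
move=> [crX _] U x clU Ux.
have /uniform_separatorP -/(_ R)[f [cf f01 fx fU]] := crX x U clU Ux.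
have uf : unit_functions R X f.
  by split=> // y; have /= := f01 (f y) (imageT f y); rewrite in_itv.
exists (exist _ f (mem_set uf)) => clf.
have : [set 1 : R] (f x).
  have /closure_id -> : closed [set 1 : R].
    by apply: accessible_closed_set1; apply: hausdorff_accessible; exact: norm_hausdorff.
  exact: closureS fU _ clf.
have -> /= : f x = 0 by apply: fx; exists x.
by move/esym/eqP; rewrite oner_eq0.
Qed.

Lemma to_stone_cech_inj X : tychonoff_space X -> injective (to_stone_cech R X).
Proof.
move=> tX x y /(congr1 val) /= xy; have [_ hX] := tX.
have inj := join_product_inj (tychonoff_unit_eval tX) (hausdorff_accessible hX).
by apply: inj xy; exact: in_setT.
Qed.

Lemma open_to_stone_cech X : tychonoff_space X ->
  @open X = @open (initial_topology (to_stone_cech R X)).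
Proof.
move=> tX; rewrite predeqE => U; split; last first.
  move=> [V oV <-]; apply: open_comp oV => x _; exact: continuous_to_stone_cech.
rewrite (join_product_initial (tychonoff_unit_eval tX)).
- move=> [V oV <-]; exists (set_val @^-1` V) => //; by exists V.
- by move=> i; have [] := set_valP i.
- move=> x y _ _ xy; apply: to_stone_cech_inj tX _ _ _; exact: val_inj.
Qed.

Lemma stone_cech_extension X K (f : X -> K) :
  compact [set: K] -> hausdorff_space K -> continuous f ->
  exists2 g : stone_cech R X -> K,
    continuous g & forall x, g (to_stone_cech R X x) = f x.
Proof.
move=> cK hK cf.
have tK : tychonoff_space K.
  split=> //; apply: (@normal_completely_regular R); first exact: compact_normal.
  exact: hausdorff_accessible.
have ctsv (i : unit_functions R K) : continuous (set_val i).
  by have [] := set_valP i.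
have ce : continuous (unit_eval R K).
  exact: join_product_continuous (tychonoff_unit_eval tK) ctsv.
have ie : set_inj [set: K] (unit_eval R K).
  exact: join_product_inj (tychonoff_unit_eval tK) (hausdorff_accessible hK).
have oe := join_product_initial (tychonoff_unit_eval tK) ctsv ie.
have pf (h : unit_functions R K) : unit_functions R X (set_val h \o f).
  have [ch h01] := set_valP h; split=> [x|x]; last exact: h01.
  by apply: continuous_comp; [exact: cf|exact: ch].
pose pull (h : unit_functions R K) : unit_functions R X :=
  exist _ (set_val h \o f) (mem_set (pf h)).
pose F (p : stone_cech R X) : prod_topology (fun _ : unit_functions R K => R) :=
  fun h => set_val p (pull h).
have cF : continuous F.
  move=> p; apply: (@cvg_unit_eval K _ (nbhs p) (nbhs_filter p)) => i.
  apply: (@continuous_comp (stone_cech R X)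
    (prod_topology (fun _ : unit_functions R X => R)) _ set_val (proj (pull i))).
    exact: initial_continuous.
  exact: proj_continuous.
have clK : closed (range (unit_eval R K)).
  apply: compact_closed; first by apply: hausdorff_product => _; exact: norm_hausdorff.
  by apply: continuous_compact cK; exact: continuous_subspaceT.
have Fe p : range (unit_eval R K) (F p).
  apply: clK => V; rewrite nbhsE => -[W [oW Wp] WV].
  have oFW : open (F @^-1` W) by have /continuousP := cF; apply.
  have FW0 : F @^-1` W !=set0 by exists p.
  have [q [WFq [x _ xq]]] := dense_to_stone_cech FW0 oFW.
  by exists (F q); split; [exists (f x); rewrite // -xq|exact: WV].
exists (fun p => sval (cid2 (Fe p))) => [|x]; last first.
  by apply: ie; rewrite ?inE//; case: cid2.
apply/continuousP => U; rewrite oe => -[V oV <-].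
suff -> : (fun p => sval (cid2 (Fe p))) @^-1` (unit_eval R K @^-1` V) = F @^-1` V.
  by have /continuousP := cF; apply.
by apply/seteqP; split=> p /=; case: cid2 => /= y _ ->.
Qed.
End stone_cech_theory.

(* Main.v *)
(** Call [P] a semi-neighbourhood of the diagonal if each [P x] is a
    neighbourhood of [x]. In a pseudocompact space [X] there is a non-empty open
    [V] such that [P] meets [A * B] for all non-empty open [A, B <= V].

    (4) => (1): apply this to [P x = x * U2 * u2^-1], where [U1 * U2 <= O], [u1] is
    in [U1] and [u2] in [U2]: the elements [u1 * x^-1 * y * u2] with [x, y] in [V]
    lie in the closure of [O]. Hence the inverse of a non-empty open set has
    interior; a second application then makes multiplication continuous at 1, and
    a third one inversion.

    (2) => (4): a separately continuous map on a product of compact spaces is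
    quasi-continuous, since otherwise two iterated limits would differ; and [G]
    is dense in its compactification.

    (1) => (3): a pseudocompact group is precompact. Counting covering translates,
    instead of using Haar measure, shows that for [f : G -> R] continuous and
    [e > 0] there are neighbourhoods [W n] of 1 whose common elements are periods
    of [f] up to [e]. Pseudocompactness then makes [f] uniformly continuous, and
    precompactness makes the multiplication extend to a jointly continuous map
    on the compactification, where the group laws hold by density. *)

Require Import Defs.
From mathcomp Require Import all_boot all_order all_algebra.
From mathcomp Require Import all_classical all_reals all_analysis.
From mathcomp Require Import lra.

Set Implicit Arguments.
Unset Strict Implicit.
Unset Printing Implicit Defensive.

Import Order.TTheory GRing.Theory Num.Theory.
Import numFieldNormedType.Exports.

Local Open Scope classical_set_scope.
Local Open Scope ring_scope.

(** * Feeble compactness and a Baire-type property *)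

Definition feebly_compact (X : topologicalType) :=
  forall U : nat -> set X, (forall n, open (U n)) -> (forall n, U n !=set0) ->
    exists x : X, forall O, nbhs x O -> forall N, exists2 n, (N <= n)%N & O `&` U n !=set0.

(** Without a cluster point, bump functions [f n] vanishing off [U n] and reaching 1 make the sum of
    all [n * f n] locally finite, hence continuous, yet unbounded. *)
Lemma pseudocompact_feebly_compact (R : realType) (X : topologicalType) :
  completely_regular_space X -> pseudocompact R X -> feebly_compact X.
Proof.
move=> crX pX U oU U0; apply: contrapT => nocluster.
have /choice[ON HON] : forall x : X, exists ON : set X * nat, nbhs x ON.1 /\
    forall n y, (ON.2 <= n)%N -> ON.1 y -> ~ U n y.
  move=> x; apply: contrapT => nx; apply: nocluster; exists x => O Ox N.
  apply: contrapT => nO; apply: nx; exists (O, N); split=> //= n y Nn Oy Uy.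
  by apply: nO; exists n => //; exists y.
have /choice[f Hf] : forall n : nat, exists f : X -> R, [/\ continuous f, forall y, 0 <= f y,
    exists2 y, U n y & f y = 1 & forall y, ~ U n y -> f y = 0].
  move=> n; have [x Ux] := U0 n.
  have := crX x (~` U n) (open_closedC (oU n)) (fun h => h Ux).
  move=> /(@uniform_separatorP _ R)[g [cg g01 gx gU]].
  exists (fun y => 1 - g y); split.
  - by move=> y; apply: cvgB; [exact: cvg_cst|exact: cg].
  - move=> y; rewrite subr_ge0.
    by have := g01 (g y) (imageT g y); rewrite /= in_itv /= => /andP[].
  - by exists x => //; rewrite (gx (g x)) ?subr0//; exists x.
  - by move=> y Uy; rewrite (gU (g y)) ?subrr//; exists y.
pose S m y := \sum_(0 <= k < m) k%:R * f k y.
have cS m : continuous (S m).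
  rewrite /S; elim: m => [|m IH] y.
    under eq_fun do rewrite big_geq//; exact: cvg_cst.
  under eq_fun do rewrite big_nat_recr//=.
  apply: cvgD; first exact: IH.
  by apply: cvgM; [exact: cvg_cst|have [+ _ _ _] := Hf m; exact].
have Sge n m y : (n <= m)%N -> (forall k, (n <= k)%N -> ~ U k y) -> S m y = S n y.
  move=> nm Uy; rewrite /S (big_cat_nat (leq0n n) nm)/= -[RHS]addr0.
  congr (_ + _); rewrite big_nat big1// => k /andP[nk _].
  by have [_ _ _ ->] := Hf k; rewrite ?mulr0//; exact: Uy.
(* The infinite sum, cut at an index past which no [U n] contains [y]. Near [x] the cut of [x] gives
   the same value. *)
pose F y := S (ON y).2 y.
have Floc x y : (ON x).1 y -> F y = S (ON x).2 y.
  move=> Oy; rewrite /F -(@Sge (ON y).2 (maxn (ON y).2 (ON x).2)) ?leq_maxl//.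
    by rewrite (@Sge (ON x).2) ?leq_maxr// => k Nk; apply: (HON x).2.
  by move=> k Nk; apply: (HON y).2 => //; exact: nbhs_singleton (HON y).1.
have cF : continuous F.
  move=> x; rewrite /F; apply: cvg_trans (cS (ON x).2 x).
  apply: near_eq_cvg; apply: filterS (HON x).1 => y Oy.
  by rewrite -(Floc x).
have [M0 [_ /(_ (M0 + 1))]] := pX F cF; rewrite ltrDl ltr01 => /(_ isT).
set M := M0 + 1 => FM.
(* At this [y] the term of index [Num.bound M] alone exceeds [M], and it lies before the cut. *)
have [_ f0 [y Uy fy] _] := Hf (Num.bound M).
have ltN : (Num.bound M < (ON y).2)%N.
  rewrite ltnNge; apply/negP => /((HON y).2 _ y); apply => //.
  exact: nbhs_singleton (HON y).1.
have : M < F y.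
  rewrite /F /S (bigD1_seq (Num.bound M)) ?iota_uniq ?mem_index_iota//=.
  rewrite fy mulr1 (lt_le_trans (unstable.ltr_bound M))// lerDl sumr_ge0// => k _.
  by rewrite mulr_ge0//; have [_ + _ _] := Hf k; exact.
rewrite ltNge => /negP; apply.
by apply: le_trans (FM y I); exact: ler_norm.
Qed.

Lemma subset_leq (T : Type) (A : nat -> set T) n m :
  (forall k, A k.+1 `<=` A k) -> (n <= m)%N -> A m `<=` A n.
Proof.
move=> AS /subnK <-; elim: (m - n)%N => // k IH; rewrite addSn.
by apply: subset_trans IH; exact: AS.
Qed.

(* Otherwise nest open sets [V n], each containing the closure of the next, so that
   no [P a] with [a] in [V n.+1] meets some open [B n] inside [V n]. A cluster
   point [x] of the [B n] lies in every [V n], so its neighbourhood [P x] misses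
   every [B n]. *)
Lemma feebly_compact_delta_baire (X : topologicalType) (P : X -> set X) :
    regular_space X -> feebly_compact X -> [set: X] !=set0 ->
    (forall x, nbhs x (P x)) ->
  exists V, [/\ open V, V !=set0 & forall A B, open A -> open B ->
    A !=set0 -> B !=set0 -> A `<=` V -> B `<=` V ->
    exists a b, [/\ A a, B b & P a b]].
Proof.
move=> regX fX X0 nP; apply: contrapT => noV.
pose state := {V : set X | open V /\ V !=set0}.
pose step (V V' : state) := closure (sval V') `<=` sval V /\
  exists B, [/\ open B, B !=set0, B `<=` sval V &
    forall a b, sval V' a -> B b -> ~ P a b].
have ex_step V : {V' | step V V'}.
  apply: cid; case: V => V [oV V0]; apply: contrapT => nstep.
  apply: noV; exists V; split=> // A B oA oB [a Aa] B0 AV BV.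
  apply: contrapT => nAB.
  have [W Wa WA] : exists2 W, nbhs a W & closure W `<=` A.
    by apply: regX; exact: open_nbhs_nbhs.
  have oW := open_interior W.
  have sW : closure W^° `<=` A.
    by apply: subset_trans WA; apply: closureS; exact: interior_subset.
  apply: nstep; exists (exist _ W^° (conj oW (ex_intro _ a Wa))).
  split=> /=; first exact: subset_trans AV.
  exists B; split=> // a' b Wa' Bb Pab; apply: nAB; exists a', b; split=> //.
  by apply: sW; exact: subset_closure.
have V0 : state by exists [set: X]; split=> //; exact: openT.
have [V [_ HV]] := dependent_choice ex_step V0.
have /choice[B HB] := fun n => (HV n).2.
have subV n m : (n <= m)%N -> sval (V m) `<=` sval (V n).
  apply: (@subset_leq _ (fun k => sval (V k))) => k.
  by apply: subset_trans (HV k).1; exact: subset_closure.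
have [n|n|x Hx] := fX B; [by have [] := HB n|by have [] := HB n|].
have Vx n : sval (V n) x.
  apply: (HV n).1 => O Ox; have [m nm [y [Oy By]]] := Hx O Ox n.+1.
  by exists y; split=> //; apply: (subV _ _ nm); have [_ _ + _] := HB m; exact.
have [n _ [y [Py By]]] := Hx _ (nP x) 0%N.
by have [_ _ _ /(_ x y)] := HB n; apply.
Qed.

(** * Separately continuous maps on compact products *)

Lemma open_setX (X Y : topologicalType) (A : set X) (B : set Y) :
  open A -> open B -> open (A `*` B).
Proof.
rewrite !openE => oA oB [x y] [/= Ax By]; exists (A, B) => //=; split.
  exact: oA.
exact: oB.
Qed.

Lemma compact_seq_cluster (X : topologicalType) (u : nat -> X) :
    compact [set: X] ->
  exists x : X, forall O, nbhs x O -> forall N, exists2 n, (N <= n)%N & O (u n).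
Proof.
move=> /(_ (u @ \oo) _)[|x [_ Hx]]; first exact: filterT.
exists x => O Ox N.
have [|_ [[n /= Nn <-] On]] := Hx (image [set n | (N <= n)%N] u) O _ Ox.
  by exists N => // n Nn; exists n.
by exists n.
Qed.

(* The failure of quasi-continuity yields sequences [a], [b] along which the
   iterated limits of [f (a i) (b j)] differ. *)
Lemma compact_separately_quasi_continuous (K L M : topologicalType)
    (f : K -> L -> M) :
    compact [set: K] -> compact [set: L] -> regular_space M ->
    separately_continuous f ->
  quasi_continuous (fun p : K * L => f p.1 p.2).
Proof.
move=> cK cL regM [fl fr] [k l] O W /= Okl [[A B] [/= Ak Bl] ABW].
apply: contrapT => noU.
(* [closure Q1] lies in [Q2^°] and [closure Q2] in [O]: one iterated limit ends in [closure Q1], the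
   other outside [Q2^°]. *)
have [Q2 Q2kl Q2O] := regM _ _ Okl.
have [Q1 Q1kl Q12] := regM _ _ (nbhs_interior Q2kl).
pose S0 := A^° `&` [set x | Q1^° (f x l)].
have oS0 : open S0.
  apply: openI; first exact: open_interior.
  by have /continuousP := fr l; apply; exact: open_interior.
(* The point [l] survives in every second factor because [f a l] is in [Q1^°] for each [a] in
   [S0]. *)
pose state := {ST : set K * set L | [/\ open ST.1, open ST.2, ST.1 !=set0,
  ST.2 l & ST.1 `<=` S0 /\ ST.2 `<=` B]}.
pose step (s t : state) :=
  let: (C, D) := sval s in let: (C', D') := sval t in
  C' `<=` C /\ D' `<=` D /\ exists a b, [/\ C' a, D b,
    forall x, C' x -> ~ closure Q2 (f x b) & forall y, D' y -> Q1 (f a y)].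
have ex_step s : {t | step s t}.
  apply: cid; case: s => -[C D] [/= oS oT S1 Tl [SS0 TB]].
  have [[a b] [Sa Tb nO]] : exists p : K * L, [/\ C p.1, D p.2 & ~ O (f p.1 p.2)].
    apply: contrapT => nST; apply: noU; exists (C `*` D); split.
    - exact: open_setX.
    - by case: S1 => a Sa; exists (a, l).
    - move=> [x y] [/= Sx Ty]; apply: ABW; split=> /=; last exact: TB.
      by apply: interior_subset; have [] := SS0 _ Sx.
    - move=> _ [[x y] [/= Sx Ty] <-]; apply: contrapT => nOxy.
      by apply: nST; exists (x, y).
  pose C' := C `&` [set x | (~` closure Q2) (f x b)].
  pose D' := D `&` [set y | Q1^° (f a y)].
  have oS' : open C'.
    apply: openI => //; have /continuousP := fr b; apply.
    by apply: closed_openC; exact: closed_closure.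
  have oT' : open D'.
    by apply: openI => //; have /continuousP := fl a; apply; exact: open_interior.
  have C'a : C' a by split=> //= /Q2O.
  have D'l : D' l by split=> //=; have [] := SS0 _ Sa.
  have C'D' : C' `<=` S0 /\ D' `<=` B.
    by split; [apply: subset_trans SS0 => x []|apply: subset_trans TB => x []].
  have p : [/\ open C', open D', C' !=set0, D' l & C' `<=` S0 /\ D' `<=` B].
    by split=> //; exists a.
  exists (exist _ (C', D') p); split; first by move=> x [].
  split; first by move=> y [].
  exists a, b; split=> //; first by move=> x [].
  by move=> y [_ /interior_subset].
have s0 : state.
  exists (S0, B^°); split=> //=; first exact: open_interior.
  - by exists k; split.
  - by split=> //; exact: interior_subset.
have [s [_ Hs]] := dependent_choice ex_step s0.
pose C n := (sval (s n)).1; pose D n := (sval (s n)).2.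
have {}Hs n : C n.+1 `<=` C n /\ D n.+1 `<=` D n /\ exists ab : K * L,
    [/\ C n.+1 ab.1, D n ab.2, forall x, C n.+1 x -> ~ closure Q2 (f x ab.2) &
      forall y, D n.+1 y -> Q1 (f ab.1 y)].
  have := Hs n; rewrite /step /C /D.
  case: (sval (s n)) => ? ?; case: (sval (s n.+1)) => ? ? [? [? [a [b ?]]]].
  by split=> //; split=> //; exists (a, b).
have /choice[ab Hab] := fun n => (Hs n).2.2.
have subS n m : (n <= m)%N -> C m `<=` C n.
  by apply: subset_leq => i; exact: (Hs i).1.
have subT n m : (n <= m)%N -> D m `<=` D n.
  by apply: subset_leq => i; exact: (Hs i).2.1.
have [a Ha] := compact_seq_cluster (fun n => (ab n).1) cK.
have [b Hb] := compact_seq_cluster (fun n => (ab n).2) cL.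
have fab j : ~ Q2^° (f a (ab j).2).
  move=> Oj; have [|i ji Oi] := Ha [set x | Q2^° (f x (ab j).2)] _ j.
    by apply: (fr _ a); apply: open_nbhs_nbhs; split=> //; exact: open_interior.
  have [_ _ /(_ (ab i).1) + _] := Hab j; apply.
    by apply: (subS _ i.+1); [rewrite ltnS|have [] := Hab i].
  by apply: subset_closure; exact: interior_subset.
have fib i : closure Q1 (f (ab i).1 b).
  move=> N Nb; have [|j ij Oj] := Hb [set y | N (f (ab i).1 y)] _ i.+1.
    exact: (fl _ b).
  exists (f (ab i).1 (ab j).2); split=> //.
  have [_ _ _] := Hab i; apply; apply: (subT _ j) => //.
  by have [] := Hab j.
have fabO : Q2^° (f a b).
  apply: Q12; rewrite [closure Q1](closure_id _).1; last exact: closed_closure.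
  move=> N Nab; have [|i _ Oi] := Ha [set x | N (f x b)] _ 0%N; first exact: (fr b a).
  by exists (f (ab i).1 b).
have [|j _ Oj] := Hb [set y | Q2^° (f a y)] _ 0%N; last exact: fab Oj.
by apply: (fl a b); apply: open_nbhs_nbhs; split=> //; exact: open_interior.
Qed.

(** * From quasi-continuous multiplication to a topological group *)

Section quasi_continuous_multiplication.
Local Open Scope group_scope.
Variable G : semitopologicalGroupType.
Implicit Types (g x y : G) (A B O T U V : set G).

Lemma open_lmulg g A : open A -> open [set x | A (g * x)].
Proof. by move=> oA; have /continuousP := (@mulg_separately_continuous G).1 g; apply. Qed.

Lemma open_rmulg g A : open A -> open [set x | A (x * g)].
Proof. by move=> oA; have /continuousP := (@mulg_separately_continuous G).2 g; apply. Qed.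

Lemma nbhs_lmulg g x A : nbhs (g * x) A -> nbhs x [set y | A (g * y)].
Proof. exact: (@mulg_separately_continuous G).1. Qed.

Lemma nbhs_rmulg g x A : nbhs (x * g) A -> nbhs x [set y | A (y * g)].
Proof. exact: (@mulg_separately_continuous G).2. Qed.

Hypothesis regG : regular_space G.
Hypothesis fcG : feebly_compact G.

(** Near [x] and [y] there are [a] and [b] with [u1 * x^-1 * a] in [U1] and [a^-1 * b * u2] in [U2].
    The product [u1 * x^-1 * b * u2] is in [O] and close to [u1 * x^-1 * y * u2]. *)
Lemma feebly_compact_div U1 U2 O u1 u2 : open U1 -> open U2 -> U1 u1 -> U2 u2 ->
    (forall x y, U1 x -> U2 y -> O (x * y)) ->
  exists V, [/\ open V, V !=set0 &
    forall x y, V x -> V y -> closure O (u1 * x^-1 * y * u2)].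
Proof.
move=> oU1 oU2 U1u U2u UO.
have [|x|V [oV V0 HV]] := @feebly_compact_delta_baire G
  (fun x => [set y | U2 (x^-1 * y * u2)]) regG fcG; first by exists 1.
  apply: (@nbhs_lmulg x^-1 x [set y | U2 (y * u2)]); apply: nbhs_rmulg.
  by apply: open_nbhs_nbhs; rewrite mulVg mul1g.
exists V; split=> // x y Vx Vy M /nbhs_interior nM.
have oM : open M^° by exact: open_interior.
have [| | | | | |a [b [[Va U1a] [Vb Mb] /= U2ab]]] := HV
  (V `&` [set a | U1 (u1 * x^-1 * a)]) (V `&` [set b | M^° (u1 * x^-1 * b * u2)]).
- by apply: openI => //; exact: open_lmulg.
- apply: openI => //.
  by apply: (@open_lmulg (u1 * x^-1) [set b | M^° (b * u2)]); exact: open_rmulg.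
- by exists x; split=> //=; rewrite mulgVK.
- by exists y; split=> //=; exact: nbhs_singleton nM.
- by move=> ? [].
- by move=> ? [].
exists (u1 * x^-1 * b * u2); split; last exact: interior_subset.
have -> : u1 * x^-1 * b * u2 = (u1 * x^-1 * a) * (a^-1 * b * u2).
  by rewrite !mulgA mulgK.
exact: UO.
Qed.

Hypothesis quasiG : quasi_continuous (fun p : G * G => p.1 * p.2).

Lemma quasi_continuous_mulg g h O U V : open O -> open U -> open V ->
    O (g * h) -> U g -> V h ->
  exists U' V', [/\ open U' /\ open V', U' !=set0 /\ V' !=set0, U' `<=` U,
    V' `<=` V & forall x y, U' x -> V' y -> O (x * y)].
Proof.
move=> oO oU oV Ogh Ug Vh.
have [||Z [oZ [[x y] Zxy] ZUV ZO]] := quasiG (z := (g, h)) (O := O) (W := U `*` V).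
- exact: open_nbhs_nbhs.
- by apply: open_nbhs_nbhs; split; [exact: open_setX|].
have [[A B] [/= Ax By] ABZ] : nbhs (x, y) Z by exact: open_nbhs_nbhs.
have sub z t : A^° z -> B^° t -> Z (z, t).
  by move=> Az Bt; apply: ABZ; split; exact: interior_subset.
exists A^°, B^°; split.
- by split; exact: open_interior.
- by split; [exists x|exists y].
- by move=> z Az; have [] := ZUV _ (sub _ _ Az By).
- by move=> z Bz; have [] := ZUV _ (sub _ _ Ax Bz).
- by move=> z t Az Bt; apply: ZO; exists (z, t) => //; exact: sub.
Qed.

Lemma feebly_continuous_invg O : open O -> O !=set0 ->
  exists E, [/\ open E, E !=set0 & forall x, E x -> O x^-1].
Proof.
move=> oO [g Og].
have [N Ng NO] : exists2 N, nbhs g N & closure N `<=` O.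
  by apply: regG; exact: open_nbhs_nbhs.
have oN : open N^° by exact: open_interior.
have [||||||U1 [U2 [[oU1 oU2] [[u1 U1u] [u2 U2u]] _ _ UN]]] :=
  @quasi_continuous_mulg g 1 N^° setT setT => //; try exact: openT.
  by rewrite mulg1; exact: nbhs_singleton (nbhs_interior Ng).
have [V [oV [v Vv] HV]] := feebly_compact_div oU1 oU2 U1u U2u UN.
(* Chosen so that [u1 * x^-1 * v * u2 = e^-1] for [x = v * u2 * e * u1]. *)
exists [set e | V (v * u2 * e * u1)]; split.
- by apply: (@open_lmulg (v * u2) [set e | V (e * u1)]); exact: open_rmulg.
- by exists (u2^-1 * u1^-1); rewrite /= mulgA mulgK mulgVK.
- move=> e Ve; apply: NO; apply: (closureS (@interior_subset _ N)).
  have := HV _ _ Ve Vv; rewrite !invgM !mulgA mulgV mul1g.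
  by rewrite !(mulgVK, mulgK).
Qed.

(* With [V] from [feebly_compact_delta_baire] for [P x = x * N] and an open [E]
   with [E^-1 <= V], the set [E * V] lies in the closure of [N]. *)
Lemma mulg_continuous_at1 T : nbhs 1 T ->
  exists A B, [/\ nbhs 1 A, nbhs 1 B & forall x y, A x -> B y -> T (x * y)].
Proof.
move=> T1; have [N N1 NT] := regG T1.
have [|x|V [oV V0 HV]] := @feebly_compact_delta_baire G
  (fun x => [set y | N (x^-1 * y)]) regG fcG; first by exists 1.
  by apply: nbhs_lmulg; rewrite mulVg.
have [E [oE [r Er] EV]] := feebly_continuous_invg oV V0.
(* Otherwise some non-empty open [U1 <= E] and [U2 <= V] have [U1 * U2] off [closure N]. An open [F]
   with [F^-1 <= U1] lies in [V], so the choice of [V] gives [a] in [F] and [b] in [U2] with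
   [a^-1 * b] in [N]. *)
have EVN x y : E x -> V y -> closure N (x * y).
  move=> Ex Vy; apply: contrapT => Nxy.
  have [||||||U1 [U2 [[oU1 oU2] [U10 U20] U1E U2V UN]]] :=
    @quasi_continuous_mulg x y (~` closure N) E V => //.
    by apply: closed_openC; exact: closed_closure.
  have [F [oF F0 FU]] := feebly_continuous_invg oU1 U10.
  have [|a [b [Fa U2b Nab]]] := HV F U2 oF oU2 F0 U20 _ U2V.
    by move=> a /FU/U1E/EV; rewrite invgK.
  by apply: (UN a^-1 b) => //; [exact: FU|exact: subset_closure].
(* Here [r] is in [E] and [r^-1] in [V], and [x * y = (x * r) * (r^-1 * y)]. *)
exists [set x | E (x * r)], [set y | V (r^-1 * y)]; split.
- by apply: nbhs_rmulg; rewrite mul1g; exact: open_nbhs_nbhs.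
- by apply: nbhs_lmulg; rewrite mulg1; apply: open_nbhs_nbhs; split=> //; exact: EV.
- by move=> x y Ex Vy; apply: NT; rewrite -(mulgK r x) -mulgA; exact: EVN.
Qed.

(** With [u1 = u2 = 1], [feebly_compact_div] puts [x^-1 = (v * x)^-1 * v] in [closure N] once [v]
    and [v * x] are in [V]. *)
Lemma invg_continuous_at1 T : nbhs 1 T -> nbhs 1 [set x | T x^-1].
Proof.
move=> T1; have [N N1 NT] := regG T1.
have [A [B [/nbhs_interior A1 /nbhs_interior B1 ABN]]] := mulg_continuous_at1 N1.
have [||||x y /interior_subset Ax /interior_subset By|V [oV [v Vv] HV]] :=
  @feebly_compact_div A^° B^° N 1 1.
- exact: open_interior.
- exact: open_interior.
- exact: nbhs_singleton.
- exact: nbhs_singleton.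
- exact: ABN.
have : nbhs 1 [set x | V (v * x)].
  by apply: nbhs_lmulg; rewrite mulg1; exact: open_nbhs_nbhs.
apply: filterS => x Vx; apply: NT; have := HV _ _ Vx Vv.
by rewrite mul1g mulg1 invgM mulgVK.
Qed.

Lemma quasi_continuous_topological_group :
  is_topological_group (@monoid.mul G) (@monoid.one G) (@monoid.inv G).
Proof.
split; [exact: mulgA|exact: mul1g|exact: mulVg| |].
- move=> [g h] T /= Tgh.
  (* Moves to 1 by [x * y = g * (g^-1 * x) * (y * h^-1) * h]. *)
  have [|A [B [A1 B1 ABT]]] := @mulg_continuous_at1 [set x | T (g * x * h)].
    apply: (@nbhs_lmulg g 1 [set x | T (x * h)]); apply: nbhs_rmulg.
    by rewrite mulg1.
  exists ([set x | A (g^-1 * x)], [set y | B (y * h^-1)]) => /=.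
    by split; [apply: nbhs_lmulg; rewrite mulVg|apply: nbhs_rmulg; rewrite mulgV].
  move=> [x y] [/= Ax By]; have := ABT _ _ Ax By.
  by rewrite /= !mulgA mulgVK mulgV mul1g.
- move=> g T Tg.
  (* Moves to 1 by [x^-1 = g^-1 * (x * g^-1)^-1]. *)
  have /invg_continuous_at1 : nbhs 1 [set x | T (g^-1 * x)].
    by apply: nbhs_lmulg; rewrite mulg1.
  rewrite -{1}(mulgV g) => /(@nbhs_rmulg g^-1 g).
  by apply: filterS => x /=; rewrite invgM invgK mulKg.
Qed.

End quasi_continuous_multiplication.

(** * Coordinates and density in the Stone-Cech compactification *)

Section stone_cech_topology.
Variable R : realType.
Implicit Types X Y : topologicalType.

Definition stone_cech_coord X (i : unit_functions R X) (p : stone_cech R X) : R :=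
  set_val p i.

Lemma continuous_stone_cech_coord X (i : unit_functions R X) :
  continuous (stone_cech_coord i).
Proof.
move=> p; apply: (@continuous_comp (stone_cech R X)
  (prod_topology (fun _ : unit_functions R X => R)) _ set_val (proj i)).
  exact: initial_continuous.
exact: proj_continuous.
Qed.

Lemma cvg_stone_cech X (T : Type) (F : set_system T) {FF : Filter F}
    (g : T -> stone_cech R X) p :
  (forall i, (fun t => stone_cech_coord i (g t)) @ F --> stone_cech_coord i p) ->
  g @ F --> p.
Proof.
move=> gp U [/= _ [[V oV <-] /= Vp] VU].
have c : (fun t => set_val (g t)) @ F --> set_val p by exact: cvg_unit_eval.
by apply: filterS VU _; apply: c; exact: open_nbhs_nbhs.
Qed.

Lemma continuous_dist X (g h : X -> R) : continuous g -> continuous h ->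
  continuous (fun x => `|g x - h x|).
Proof. by move=> cg ch x; apply: cvg_norm; apply: cvgB; [exact: cg|exact: ch]. Qed.

Lemma continuous_coord_comp X Y (i : unit_functions R Y) (g : X -> stone_cech R Y) :
  continuous g -> continuous (fun x => stone_cech_coord i (g x)).
Proof.
move=> cg x; apply: continuous_comp; first exact: cg.
exact: continuous_stone_cech_coord.
Qed.

Lemma le_closure X (g : X -> R) (A : set X) (e : R) : continuous g ->
  (forall x, A x -> g x <= e) -> forall p, closure A p -> g p <= e.
Proof.
move=> /continuous_closedP cg Ae p Ap.
have /closure_id cle : closed [set x | g x <= e] := cg _ (@closed_le R e).
by have : closure [set x | g x <= e] p by [exact: closureS Ap]; rewrite -cle.
Qed.

Lemma closure_range_to_stone_cech X (p : stone_cech R X) :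
  closure (range (to_stone_cech R X)) p.
Proof.
move=> B /nbhs_interior Bp; have [| |y [/interior_subset By xy]] :=
  @dense_to_stone_cech R X B^°.
- by exists p; exact: nbhs_singleton.
- exact: open_interior.
by exists y.
Qed.

Lemma le_stone_cech X (g : stone_cech R X -> R) (e : R) : continuous g ->
  (forall x, g (to_stone_cech R X x) <= e) -> forall p, g p <= e.
Proof.
move=> cg ge p; apply: (@le_closure _ g (range (to_stone_cech R X))) => //.
  by move=> _ [x _ <-]; exact: ge.
exact: closure_range_to_stone_cech.
Qed.

Lemma stone_cech_eq X Y (g h : stone_cech R X -> stone_cech R Y) :
    continuous g -> continuous h ->
    (forall x, g (to_stone_cech R X x) = h (to_stone_cech R X x)) ->
  forall p, g p = h p.
Proof.
move=> cg ch gh p; apply/val_inj/funext => i; apply/eqP; rewrite -subr_eq0 -normr_le0.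
apply: (@le_stone_cech X (fun p => `|stone_cech_coord i (g p) -
  stone_cech_coord i (h p)|)) => [q|x]; last by rewrite gh subrr normr0.
by apply: continuous_dist q; exact: continuous_coord_comp.
Qed.

Lemma nbhs_forall_seq X (I : eqType) (s : seq I) (P : I -> set X) (x : X) :
  (forall i, i \in s -> nbhs x (P i)) ->
  nbhs x [set y | forall i, i \in s -> P i y].
Proof.
elim: s => [_|i s IH sP]; first exact: filterE.
have ns : nbhs x [set y | forall i, i \in s -> P i y].
  by apply: IH => j js; apply: sP; rewrite inE js orbT.
have ni : nbhs x (P i) by apply: sP; rewrite inE eqxx.
by apply: filterS (filterI ni ns) => y [Piy Psy] j; rewrite inE => /orP[/eqP->|/Psy].
Qed.

End stone_cech_topology.

(** * Precompactness and counting of translates *)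

Section topological_group.
Local Open Scope group_scope.
Variable G : semitopologicalGroupType.
Implicit Types (g s u v x y z : G) (V W : set G) (F S : seq G).

Hypothesis contM : continuous (fun p : G * G => p.1 * p.2).
Hypothesis contV : continuous (@monoid.inv G).

Definition sym_nbhs1 V := [/\ open V, V 1 & forall x, V x -> V x^-1].

Lemma sym_nbhs1_nbhs V : sym_nbhs1 V -> nbhs 1 V.
Proof. by move=> [oV V1 _]; exact: open_nbhs_nbhs. Qed.

Lemma sym_nbhs1_mul2 V : nbhs 1 V ->
  exists2 W, sym_nbhs1 W & forall x y, W x -> W y -> V (x * y).
Proof.
move=> V1.
have [[A B] [/= A1 B1] ABV] : nbhs ((1, 1) : G * G) [set p | V (p.1 * p.2)].
  by apply: contM; rewrite /= mulg1.
pose C := (A `&` B)°.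
have oC : open C by exact: open_interior.
have C1 : C 1 by apply: nbhs_singleton; apply: nbhs_interior; exact: filterI.
have CAB x : C x -> A x /\ B x by move=> /interior_subset.
exists (C `&` [set x | C x^-1]).
  split=> [| |x [Cx CVx]].
  - by apply: openI => //; have /continuousP := contV; exact.
  - by split=> //=; rewrite invg1.
  - by split=> //=; rewrite invgK.
move=> x y [/CAB[Ax _] _] [/CAB[_ By] _].
exact: (ABV (x, y)).
Qed.

Lemma sym_nbhs1_mul4 V : nbhs 1 V -> exists2 W, sym_nbhs1 W &
  forall x y z t, W x -> W y -> W z -> W t -> V (x * y * z * t).
Proof.
move=> /sym_nbhs1_mul2[W' /sym_nbhs1_nbhs/sym_nbhs1_mul2[W sW WW'] W'V].
by exists W => // x y z t *; rewrite -mulgA; apply: W'V; exact: WW'.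
Qed.

Definition covers V F := forall g, exists2 c, c \in F & V (c^-1 * g).

(** Otherwise choose [x n] outside all [x m * V] with [m < n]. With [W] symmetric and its fourth
    power in [V], the sets [x n * W] cluster at some [z]; two of them meet [z * W], which forces
    [(x m)^-1 * x n] into [V]. *)
Lemma feebly_compact_precompact V :
  feebly_compact G -> nbhs 1 V -> exists F, covers V F.
Proof.
move=> fcG V1; apply: contrapT => ncov.
have /choice[next Hnext] : forall F, exists g, forall c, c \in F -> ~ V (c^-1 * g).
  move=> F; apply: contrapT => nF; apply: ncov; exists F => g.
  apply: contrapT => ng; apply: nF; exists g => c cF Vcg; apply: ng.
  by exists c.
pose s n := iter n (fun F => next F :: F) [::].
pose x n := next (s n).
have xs m n : (m < n)%N -> x m \in s n.
  elim: n => // n IH; rewrite ltnS leq_eqVlt inE => /orP[/eqP->|/IH->].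
    by rewrite eqxx.
  by rewrite orbT.
have [W [oW W1 WV] W4] := sym_nbhs1_mul4 V1.
have [n|n|z Hz] := fcG (fun n => [set y | W ((x n)^-1 * y)]).
- exact: open_lmulg.
- by exists (x n); rewrite /= mulVg.
have nz : nbhs z [set y | W (z^-1 * y)].
  by apply: nbhs_lmulg; rewrite mulVg; exact: open_nbhs_nbhs.
have [m _ [y [/= zy xmy]]] := Hz _ nz 0%N.
have [n mn [t [/= zt xnt]]] := Hz _ nz m.+1.
apply: (Hnext (s n) (x m)); first exact: xs.
have -> : (x m)^-1 * next (s n) =
    (x m)^-1 * y * (z^-1 * y)^-1 * (z^-1 * t) * ((x n)^-1 * t)^-1.
  by rewrite !invgM !invgK !mulgA !(mulgVK, mulgK).
by apply: W4 => //; exact: WV.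
Qed.

(* Counts covering translates of a small [W], an approximate Haar measure in
   which each translate of [V i] occupies at least [1 / k] of the group. *)
Lemma card_separated_translates (N k : nat) (u : nat -> G) (V : nat -> set G) W :
    (exists F, covers W F) ->
    (forall i, (i < N)%N -> exists2 F, (size F <= k)%N & covers (V i) F) ->
    (forall i j s x y, (i < N)%N -> (j < N)%N -> W (s^-1 * x) -> W (s^-1 * y) ->
      V i ((u i)^-1 * x) -> V j ((u j)^-1 * y) -> i = j) ->
  (N <= k)%N.
Proof.
move=> [F0 covF0] covV sepV.
pose card n := `[< exists2 S, size S = n & covers W S >].
have exn : exists n, card n by exists (size F0); apply/asboolP; exists F0.
case: (ex_minnP exn) => n /asboolP[S sizeS covS] minS.
have n0 : (0 < n)%N.
  by rewrite -sizeS; case: (S) covS => // /(_ 1)[c].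
pose p i s := `[< exists2 x, W (s^-1 * x) & V i ((u i)^-1 * x) >].
(* If the [c * V i] cover, each [g] has [u i * c^-1 * g] in [u i * V i] and in some [s * W]. So the
   [c * (u i)^-1 * s] with [p i s] give a cover by translates of [W], of size at least the minimum
   [n]. *)
have nle i : (i < N)%N -> (n <= k * count (p i) S)%N.
  move=> iN; have [F sizeF covF] := covV i iN.
  apply: (@leq_trans (size F * count (p i) S)); last by rewrite leq_mul2r sizeF orbT.
  rewrite -size_filter -(size_allpairs (fun c s => c * (u i)^-1 * s)).
  apply: minS; apply/asboolP; eexists; first by [].
  move=> g; have [c cF Vcg] := covF g.
  have [s sS Wsg] := covS (u i * (c^-1 * g)).
  exists (c * (u i)^-1 * s).
    apply: allpairs_f => //; rewrite mem_filter sS andbT; apply/asboolP.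
    by exists (u i * (c^-1 * g)); rewrite ?mulKg.
  by rewrite !invgM invgK -!mulgA.
(* By separation, each [s * W] meets at most one [u i * V i]. *)
have sum_count : (\sum_(i < N) count (p i) S <= n)%N.
  have countE i : (count (p i) S = \sum_(s <- S) p i s)%N.
    by rewrite -sumn_count sumnE big_map.
  rewrite -sizeS -sum1_size.
  rewrite (eq_bigr (fun i : 'I_N => \sum_(s <- S) p i s)%N) => [|i _]; last exact: countE.
  rewrite exchange_big/=; apply: leq_sum => s _.
  have [[i pis]|np] := pselect (exists i : 'I_N, p i s).
    rewrite (bigD1 i)//= pis big1 ?addn0// => j ji.
    apply/eqP; rewrite eqb0; apply/negP => pjs; move: ji.
    have /asboolP[x Wx Vx] := pis; have /asboolP[y Wy Vy] := pjs.
    have /val_inj-> : j = i :> nat by exact: (sepV _ _ s y x).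
    by rewrite eqxx.
  by rewrite big1// => i _; apply/eqP; rewrite eqb0; apply/negP => pis; case: np; exists i.
rewrite -(leq_pmul2r n0); apply: leq_trans (_ : (k * \sum_(i < N) count (p i) S <= _)%N).
  rewrite big_distrr/= -[X in (X * n)%N]card_ord -sum_nat_const.
  by apply: leq_sum => i _; exact: nle.
by rewrite leq_mul2l sum_count orbT.
Qed.


(** * Uniform continuity of continuous functions *)

Section uniform_continuity.
Variables (R : realType) (f : G -> R).
Hypothesis fcG : feebly_compact G.
Hypothesis contf : continuous f.

Let nbhs_dist (x : G) (e : R) : 0 < e -> nbhs x [set y | `|f x - f y| < e].
Proof. by move=> e0; have /cvgrPdist_lt := @contf x; apply. Qed.

(** The bound [k] on the number of covering translates makes [V] large. Of the three factors, two
    reach a point common to two boxes [x * V * V]; the third is the shift tested as a period. *)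
Definition small_box (e : R) (k : nat) x V := [/\ sym_nbhs1 V,
  exists2 F, (size F <= k)%N & covers V F &
  forall a b c, V a -> V b -> V c -> `|f x - f (x * a * b * c)| <= e].

(* [W] is the intersection of the boxes in a maximal disjoint family; such a
   family has at most [k] members. *)
Lemma small_box_uniform (e : R) (k : nat) : exists2 W, nbhs 1 W &
  forall x V, small_box e k x V -> exists a b,
    [/\ V a, V b & forall h, W h -> `|f (x * a * b) - f (x * a * b * h)| <= e + e].
Proof.
pose family N (uV : nat -> G * set G) :=
  (forall i, (i < N)%N -> small_box e k (uV i).1 (uV i).2) /\
  forall i j a b c d, (i < N)%N -> (j < N)%N ->
    (uV i).2 a -> (uV i).2 b -> (uV j).2 c -> (uV j).2 d ->
    (uV i).1 * a * b = (uV j).1 * c * d -> i = j.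
pose card N := `[< exists uV, family N uV >].
have ex_card : exists N, card N.
  by exists 0%N; apply/asboolP; exists (fun=> (1, setT)); split.
have family_nbhs N uV : family N uV -> nbhs 1 [set x | forall i, (i < N)%N -> (uV i).2 x].
  move=> [box _]; suff : forall n, (n <= N)%N ->
      nbhs 1 [set x | forall i, (i < n)%N -> (uV i).2 x] by exact.
  elim=> [_|n IH nN]; first by apply: filterE => x i.
  have [/sym_nbhs1_nbhs Vn _ _] := box n nN.
  apply: filterS (filterI Vn (IH (ltnW nN))) => x [Vx Hx] i.
  by rewrite ltnS leq_eqVlt => /orP[/eqP->|/Hx].
(* By symmetry of the sets, if [s * W] meets [u i * V i] and [u j * V j], then [s] lies in both
   boxes [u i * V i * V i] and [u j * V j * V j], so [i = j]. *)
have card_le N : card N -> (N <= k)%N.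
  move=> /asboolP[uV fam]; have [box disj] := fam.
  apply: (@card_separated_translates N k (fst \o uV) (snd \o uV)
    [set x | forall i, (i < N)%N -> (uV i).2 x]) => /=.
  - by apply: feebly_compact_precompact => //; exact: family_nbhs.
  - by move=> i iN; have [] := box i iN.
  - move=> i j s x y iN jN Wx Wy Vx Vy.
    have Vinv l z : (l < N)%N -> (uV l).2 z -> (uV l).2 z^-1.
      by move=> lN; have [[_ _ +] _ _] := box l lN; exact.
    apply: (disj _ _ ((uV i).1^-1 * x) (s^-1 * x)^-1 ((uV j).1^-1 * y) (s^-1 * y)^-1) => //.
    - exact/Vinv/Wx.
    - exact/Vinv/Wy.
    - by rewrite !invgM !invgK !mulVKg.
case: (ex_maxnP ex_card card_le) => N /asboolP[uV fam] maxN.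
exists [set x | forall i, (i < N)%N -> (uV i).2 x]; first exact: family_nbhs.
have [box disj] := fam.
move=> x V boxV; have [symV _ fV] := boxV.
(* By maximality, the box of [V] at [x] meets one of the family. *)
have [i [iN [a [b [c [d [Va Vb [Vc Vd] xab]]]]]]] : exists i, (i < N)%N /\
    exists a b c d, [/\ V a, V b, (uV i).2 c /\ (uV i).2 d &
      x * a * b = (uV i).1 * c * d].
  apply: contrapT => ndisj.
  suff /maxN : card N.+1 by rewrite ltnn.
  apply/asboolP; exists (fun i => if (i < N)%N then uV i else (x, V)); split.
    by move=> i _; case: ifPn => // iN; exact: box.
  move=> i j a b c d; rewrite !ltnS => iN jN.
  case: ifPn => iN'; case: ifPn => jN' /=; first exact: disj.
  - move=> ia ib Vc Vd E; case: ndisj; exists i; split=> //.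
    by exists c, d, a, b.
  - move=> Va Vb jc jd E; case: ndisj; exists j; split=> //.
    by exists a, b, c, d.
  - move=> *; apply/eqP; rewrite eqn_leq (leq_trans iN) ?(leq_trans jN) // leqNgt //.
exists a, b; split=> // h Wh; rewrite xab.
have [[_ V1 _] _ fVi] := box i iN.
rewrite (le_trans (ler_distD (f (uV i).1) _ _))// lerD//.
  by rewrite distrC -(mulg1 (_ * d)) fVi.
by rewrite fVi//; exact: Wh.
Qed.

(* The points [x * a * b] given by [small_box_uniform], for all [k], are dense. *)
Lemma exists_period_sets (e : R) : 0 < e ->
  exists2 W : nat -> set G, forall n, nbhs 1 (W n) &
    forall h, (forall n, W n h) -> forall x, `|f x - f (x * h)| <= e.
Proof.
move=> e0; have e2 : 0 < (e / 2)%R by rewrite divr_gt0.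
have /choice[W HW] : forall k, exists W : set G, nbhs 1 W /\
    forall x V, small_box (e / 2) k x V -> exists a b, [/\ V a, V b &
      forall h, W h -> `|f (x * a * b) - f (x * a * b * h)| <= (e / 2)%R + (e / 2)%R].
  by move=> k; have [W W1 HW] := small_box_uniform (e / 2) k; exists W.
exists W; first by move=> n; have [] := HW n.
move=> h Wh x; apply/ler_addgt0Pr => d d0; have d2 : 0 < (d / 2)%R by rewrite divr_gt0.
have nx : nbhs 1 [set v | `|f x - f (x * v)| < (e / 2)%R /\
    (`|f x - f (x * v)| < (d / 2)%R /\ `|f (x * h) - f (x * v * h)| < (d / 2)%R)].
  have xnbhs (P : set G) : nbhs x P -> nbhs 1 [set v | P (x * v)].
    by move=> Px; apply: nbhs_lmulg; rewrite mulg1.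
  have n1 := xnbhs _ (nbhs_dist x e2).
  have n2 := xnbhs _ (nbhs_dist x d2).
  have n3 := xnbhs _ (nbhs_rmulg (nbhs_dist (x * h) d2)).
  exact: filterI n1 (filterI n2 n3).
have [V symV V4] := sym_nbhs1_mul4 nx; have [oV V1 _] := symV.
(* [V] depends on [h] and [d], so [size F] is not known in advance: this is why [h] is taken in
   every [W k]. *)
have [F covF] := feebly_compact_precompact fcG (sym_nbhs1_nbhs symV).
have [|a [b [Va Vb fab]]] := (HW (size F)).2 x V.
  split=> //; first by exists F.
  move=> a b c Va Vb Vc.
  by have [/ltW + _] := V4 _ _ _ _ Va Vb Vc V1; rewrite /= mulg1 !mulgA.
have [_ []] := V4 _ _ _ _ Va Vb V1 V1; rewrite /= !mulg1 !mulgA => xab xabh.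
have {}fab := fab h (Wh _); rewrite distrC in xabh.
rewrite (le_trans (ler_distD (f (x * a * b)) _ _))//.
rewrite (le_trans (lerD (lexx _) (ler_distD (f (x * a * b * h)) _ _)))//.
rewrite [e in e + d]splitr [d in _ + d]splitr; lra.
Qed.

(* Otherwise [f x] and [f (x * w n)] stay [e] apart for [x] in an open set [X n].
   Take a cluster point [z] of the [X n], then a cluster point [z'] of the
   translates by [w n] of the parts of [X n] that approach [z]: the element
   [z^-1 * z'] is a period of [f] up to [e / 4]. *)
Lemma left_uniformly_continuous (e : R) : 0 < e ->
  exists2 V, nbhs 1 V & forall x v, V v -> `|f x - f (x * v)| <= e.
Proof.
move=> e0; pose r := (e / 4)%R; have r0 : 0 < r by rewrite divr_gt0.
have [W W1 HW] := exists_period_sets r0.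
apply: contrapT => nunif.
(* Yields [C n] with [C n.+1 * C n.+1] inside both [C n] and [W n]; [setT] is a dummy value when [V]
   is not a neighbourhood of 1. *)
have /choice[D HD] : forall nV : nat * set G, exists D, nbhs 1 nV.2 ->
    sym_nbhs1 D /\ forall x y, D x -> D y -> nV.2 (x * y) /\ W nV.1 (x * y).
  move=> [n V] /=; have [V1|nV] := pselect (nbhs 1 V); last by exists setT.
  have [D symD DV] := sym_nbhs1_mul2 (filterI V1 (W1 n)).
  by exists D.
pose fix C n := if n is m.+1 then D (m, C m) else D (0%N, setT).
have symC n : sym_nbhs1 (C n).
  elim: n => [|n IH] /=; first by have [] := HD (0%N, setT) (filterT : nbhs (1 : G) setT).
  by have [] := HD (n, C n) (sym_nbhs1_nbhs IH).
have C1 n : C n 1 by have [] := symC n.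
have CV n x : C n x -> C n x^-1 by have [_ _] := symC n; exact.
have CS n x y : C n.+1 x -> C n.+1 y -> C n (x * y) /\ W n (x * y).
  by have [_] := HD (n, C n) (sym_nbhs1_nbhs (symC n)); exact.
have CleS n x : C n.+1 x -> C n x.
  by move=> Cx; have [] := CS n x 1 Cx (C1 _); rewrite mulg1.
have Cle n m : (n <= m)%N -> C m `<=` C n.
  by apply: subset_leq => k x; exact: CleS.
have /choice[w Hw] : forall n, exists w, C n w /\ exists x, e < `|f x - f (x * w)|.
  move=> n; apply: contrapT => nw; apply: nunif.
  exists (C n); first exact: sym_nbhs1_nbhs.
  move=> x v Cv; rewrite leNgt; apply/negP => efx; apply: nw.
  by exists v; split=> //; exists x.
have open_lt (g : G -> R) (c : R) : continuous g -> open [set x | c < g x].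
  by move=> /continuousP cg; exact: (cg _ (@open_gt R c)).
pose X n := [set x | e < `|f x - f (x * w n)|].
have oX n : open (X n).
  apply: open_lt => x; apply: cvg_norm; apply: cvgB; first exact: contf.
  by apply: (cvg_comp _ _ ((@mulg_separately_continuous G).2 (w n) x)); exact: contf.
have [n|z Hz] := fcG oX; first by have [] := Hw n.
have nz n : nbhs z [set x | `|f z - f x| < r /\ C n (z^-1 * x)].
  apply: filterI; first exact: nbhs_dist.
  by apply: nbhs_lmulg; rewrite mulVg; exact: sym_nbhs1_nbhs.
have /choice[i Hi] : forall n, exists i, (n <= i)%N /\
    ([set x | `|f z - f x| < r /\ C n (z^-1 * x)]° `&` X i) !=set0.
  by move=> n; have [i ni] := Hz _ (nbhs_interior (nz n)) n; exists i.
pose Y n := [set y |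
  ([set x | `|f z - f x| < r /\ C n (z^-1 * x)]° `&` X (i n)) (y * (w (i n))^-1)].
have [n|n|z' Hz'] := @fcG Y.
- by apply: open_rmulg; apply: openI => //; exact: open_interior.
- by have [_ [x Hx]] := Hi n; exists (x * w (i n)); rewrite /Y /= mulgK.
(* The index drops by one since [z^-1 * y] is a product of two elements of [C n.+1], the second
   being [w (i n.+1)]. *)
have HY n y : Y n.+1 y -> e - r <= `|f z - f y| /\ C n (z^-1 * y).
  move=> [/interior_subset[zy Cy]]; rewrite /X /= mulgVK => ey; split.
    rewrite lerBlDl ltW// (lt_le_trans ey)//.
    rewrite (le_trans (ler_distD (f z) _ _))// lerD2r ltW// distrC//.
  have [+ _] := CS n _ (w (i n.+1)) Cy (Cle _ _ (Hi n.+1).1 _ (Hw _).1).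
  by rewrite -mulgA mulgVK.
have Wz n : W n (z^-1 * z').
  have nz' : nbhs z' [set y | C n.+1 (z'^-1 * y)].
    by apply: nbhs_lmulg; rewrite mulVg; exact: sym_nbhs1_nbhs.
  have [[//|m] nm [y [/= Cy /HY[_ Czy]]]] := Hz' _ nz' n.+2.
  have [_] := CS n _ _ (Cle n.+1 m nm _ Czy) (CV n.+1 _ Cy).
  by rewrite invgM invgK -mulgA mulVKg.
(* Now [3 * r <= |f z - f y|], while passing through [f z'] bounds it by less than [2 * r]. *)
have [[//|m] _ [y [/= fy /HY[efy _]]]] := Hz' _ (nbhs_dist z' r0) 1%N.
have := HW _ Wz z; rewrite mulVKg => fz.
have := ler_distD (f z') (f z) (f y); rewrite /r in fz fy efy *; lra.
Qed.

End uniform_continuity.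


(** * Extending the group structure to the compactification *)

Section extension.
Variable R : realType.
Hypothesis fcG : feebly_compact G.

Lemma right_uniformly_continuous (f : G -> R) (e : R) : continuous f -> 0 < e ->
  exists2 V, nbhs 1 V & forall x v, V v -> `|f x - f (v * x)| <= e.
Proof.
move=> contf e0.
have cfV : continuous (f \o @monoid.inv G).
  by move=> x; apply: continuous_comp; [exact: contV|exact: contf].
have [V V1 fV] := left_uniformly_continuous fcG cfV e0.
exists [set v | V v^-1]; first by apply: contV; rewrite invg1.
by move=> x v /(fV x^-1); rewrite /= invgM !invgK.
Qed.

(** Each left translation extends to [L x]. Uniform continuity of the coordinates makes [L x q]
    continuous in [x], uniformly in [q], so it extends again, to [M q]. A finite cover then upgrades
    this to joint continuity. *)
Lemma pseudocompact_stone_cech_mul :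
  exists2 m : stone_cech R G -> stone_cech R G -> stone_cech R G,
    extends_to_stone_cech (@monoid.mul G) m &
    continuous (fun p : stone_cech R G * stone_cech R G => m p.1 p.2).
Proof.
pose SC := stone_cech R G; pose iota := to_stone_cech R G.
have /choice[L HL] : forall x, exists L : SC -> SC,
    continuous L /\ forall y, L (iota y) = iota (x * y).
  move=> x; have [|L cL HL] := @stone_cech_extension R G SC (iota \o monoid.mul x)
    (@compact_stone_cech R G) (@hausdorff_stone_cech R G).
    move=> y; apply: continuous_comp; last exact: continuous_to_stone_cech.
    exact: (@mulg_separately_continuous G).1.
  by exists L.
have L_close i e : 0 < e -> exists2 V, nbhs 1 V & forall x v q, V v ->
    `|stone_cech_coord i (L x q) - stone_cech_coord i (L (v * x) q)| <= e.
  move=> e0; have [ci _] := set_valP i.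
  have [V V1 HV] := right_uniformly_continuous ci e0.
  exists V => // x v q Vv.
  apply: (@le_stone_cech R G (fun q => `|stone_cech_coord i (L x q) -
    stone_cech_coord i (L (v * x) q)|)) => [p|y].
    by apply: continuous_dist p; apply: continuous_coord_comp; exact: (HL _).1.
  by rewrite !(HL _).2 -mulgA; exact: HV.
have /choice[M HM] : forall q, exists M : SC -> SC,
    continuous M /\ forall x, M (iota x) = L x q.
  move=> q; have [|M cM HM] := @stone_cech_extension R G SC (L ^~ q)
    (@compact_stone_cech R G) (@hausdorff_stone_cech R G).
    move=> x; apply: cvg_stone_cech => i; apply/cvgrPdist_le => e e0.
    have [V V1 HV] := L_close i e e0.
    have : nbhs x [set y | V (y * x^-1)] by apply: nbhs_rmulg; rewrite mulgV.
    by apply: filterS => y /(HV x _ q); rewrite mulgVK.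
  by exists M.
exists (fun p q => M q p); first by move=> x y; rewrite (HM _).2 (HL _).2.
move=> [p q]; apply: cvg_stone_cech => i; apply/cvgrPdist_le => e e0 /=.
have e4 : 0 < (e / 4)%R by rewrite divr_gt0.
have [V V1 HV] := L_close i _ e4.
have [F covF] : exists F, covers [set v | V v^-1] F.
  by apply: feebly_compact_precompact => //; apply: contV; rewrite invg1.
(* The closure of [V * c^-1], where [M q'] is within [e / 4] of [L c^-1 q']. Covering by [V^-1] on
   the left becomes, after inversion, covering by these right translates. *)
pose A c := closure (iota @` [set g | V (g * c)]).
have M_close c p' q' : A c p' ->
    `|stone_cech_coord i (L c^-1 q') - stone_cech_coord i (M q' p')| <= (e / 4)%R.
  apply: (@le_closure _ _ (fun p' => `|stone_cech_coord i (L c^-1 q') -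
    stone_cech_coord i (M q' p')|)) => [r|_ [g Vgc <-]].
    apply: continuous_dist r; first by move=> x; exact: cst_continuous.
    by apply: continuous_coord_comp; exact: (HM _).1.
  by rewrite (HM _).2; have := HV c^-1 _ q' Vgc; rewrite mulgK.
(* [F] being finite, some neighbourhood of [r] misses every closed [A c] that omits [r]. *)
have near_A r : nbhs r [set p' | forall c, c \in F -> A c p' -> A c r].
  apply: nbhs_forall_seq => c _; have [Ar|nAr] := pselect (A c r).
    exact: filterE.
  have : nbhs r (~` A c).
    by apply: open_nbhs_nbhs; split=> //; apply: closed_openC; exact: closed_closure.
  by apply: filterS.
have A_cover r : exists2 c, c \in F & A c r.
  have [r' [Hg [g _ gr]]] : (
      [set p' | forall c, c \in F -> A c p' -> A c r]° `&` range iota) !=set0.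
    apply: dense_to_stone_cech; last exact: open_interior.
    by exists r; exact: near_A.
  have [c cF Vgc] := covF g^-1.
  exists c => //; apply: (interior_subset Hg) => //; rewrite -gr.
  apply: subset_closure; exists g => //.
  by move: Vgc; rewrite /= invgM !invgK.
have near_L : nbhs q [set q' | forall c, c \in F -> `|stone_cech_coord i (L c^-1 q) -
    stone_cech_coord i (L c^-1 q')| <= (e / 4)%R].
  apply: nbhs_forall_seq => c _.
  have : stone_cech_coord i (L c^-1 q') @[q' --> q] --> stone_cech_coord i (L c^-1 q).
    exact: continuous_coord_comp (HL _).1 q.
  by move/cvgrPdist_le; apply.
exists ([set p' | forall c, c \in F -> A c p' -> A c p],
  [set q' | forall c, c \in F -> `|stone_cech_coord i (L c^-1 q) -
    stone_cech_coord i (L c^-1 q')| <= (e / 4)%R]) => /=.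
  by split; [exact: near_A|exact: near_L].
move=> [p' q'] [/= Hp Hq]; have [c cF Acp'] := A_cover p'.
(* Both [p] and [p'] are in [A c]: three errors of [e / 4], from [M q p] through [L c^-1 q] and
   [L c^-1 q'] to [M q' p']. *)
have := M_close _ _ q' Acp'; have := Hq c cF; have := M_close _ _ q (Hp c cF Acp').
rewrite !ler_distl => ? ? ?; lra.
Qed.

Lemma pseudocompact_stone_cech_group :
  exists m : stone_cech R G -> stone_cech R G -> stone_cech R G,
    [/\ extends_to_stone_cech (@monoid.mul G) m, separately_continuous m &
      exists e i, is_topological_group m e i].
Proof.
pose SC := stone_cech R G; pose iota := to_stone_cech R G.
have [m mE cm] := pseudocompact_stone_cech_mul.
have contm (X : topologicalType) (g h : X -> SC) :
    continuous g -> continuous h -> continuous (fun t => m (g t) (h t)).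
  move=> cg ch t; apply: (@continuous_comp X (SC * SC)%type SC
    (fun t => (g t, h t)) (fun p => m p.1 p.2)); last exact: cm.
  exact: cvg_pair (cg t) (ch t).
have contid (X : topologicalType) : continuous (@id X) by move=> t.
have cml p : continuous (m p) by exact: contm (@cst_continuous _ _ p) (contid _).
have cmr q : continuous (m ^~ q) by exact: contm (contid _) (@cst_continuous _ _ q).
have [|J cJ JE] := @stone_cech_extension R G SC (iota \o @monoid.inv G)
    (@compact_stone_cech R G) (@hausdorff_stone_cech R G).
  move=> x; apply: continuous_comp; first exact: contV.
  exact: continuous_to_stone_cech.
exists m; split=> //; exists (iota 1), J; split=> //.
(* Density is used in one variable at a time. *)
- move=> p q r; move: p; apply: stone_cech_eq => [||x].
  + exact: cmr.
  + by apply: (contm SC (m ^~ q) (cst r)) => //; exact: cst_continuous.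
  move: q; apply: stone_cech_eq => [||y].
  + by apply: (contm SC (cst (iota x)) (m ^~ r)) => //; exact: cst_continuous.
  + by apply: (contm SC (m (iota x)) (cst r)) => //; exact: cst_continuous.
  move: r; apply: stone_cech_eq => [||z].
  + by apply: (contm SC (cst (iota x)) (m (iota y))) => //; exact: cst_continuous.
  + exact: cml.
  by rewrite !mE mulgA.
- apply: stone_cech_eq => [||x]; [exact: cml|exact: contid|].
  by rewrite mE mul1g.
- apply: stone_cech_eq => [||x].
  + exact: contm cJ (contid _).
  + exact: cst_continuous.
  by rewrite JE mE mulVg.
Qed.

End extension.

End topological_group.

(** * Descent to the original space and the equivalences *)

(** Open sets of [X] are traces of open sets of its compactification, and an open set found in the
    square of the latter meets the dense image of [X * X]. *)
Lemma extension_quasi_continuous (R : realType) (X : topologicalType)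
    (mul : X -> X -> X) (m : stone_cech R X -> stone_cech R X -> stone_cech R X) :
    tychonoff_space X -> extends_to_stone_cech mul m -> separately_continuous m ->
  quasi_continuous (fun p : X * X => mul p.1 p.2).
Proof.
move=> tX mE sm [g h] O W /= Ogh [[A B] [/= Ag Bh] ABW].
have nbhs_ext x (V : set X) : nbhs x V ->
    exists V' : set (stone_cech R X), [/\ open V', V' (to_stone_cech R X x) &
      to_stone_cech R X @^-1` V' `<=` V].
  move=> /nbhs_interior/nbhs_singleton Vx.
  have : open V^° by exact: open_interior.
  rewrite (open_to_stone_cech R tX) => -[V' oV' V'E].
  by exists V'; rewrite V'E; split=> //; [rewrite -V'E in Vx|exact: interior_subset].
have [N [oN Ngh NO]] := nbhs_ext _ _ Ogh.
have [A' [oA' A'g A'A]] := nbhs_ext _ _ Ag.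
have [B' [oB' B'h B'B]] := nbhs_ext _ _ Bh.
have regSC : regular_space (stone_cech R X).
  move=> p; apply: (@compact_regular _ p setT); last exact: filterT.
    exact: hausdorff_stone_cech.
  exact: compact_stone_cech.
have [||U' [oU' [[p q] U'pq] U'W U'O]] := compact_separately_quasi_continuous
    (@compact_stone_cech R X) (@compact_stone_cech R X) regSC sm
    (z := (to_stone_cech R X g, to_stone_cech R X h)) (O := N) (W := A' `*` B').
- by apply: open_nbhs_nbhs; rewrite /= mE.
- by apply: open_nbhs_nbhs; split; [exact: open_setX|].
pose io (x : X * X) := (to_stone_cech R X x.1, to_stone_cech R X x.2).
have cio : continuous io.
  move=> [x y] V [[C D] [/= Cx Dy] CDV].
  have nC := @continuous_to_stone_cech R X x C Cx.
  have nD := @continuous_to_stone_cech R X y D Dy.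
  by exists (to_stone_cech R X @^-1` C, to_stone_cech R X @^-1` D) => // -[u v] [/= Cu Dv];
    exact: (CDV (_, _)).
exists (io @^-1` U'); split.
- by have /continuousP := cio; apply.
- have [[P Q] [/= Pp Qq] PQ] : nbhs (p, q) U' by exact: open_nbhs_nbhs.
  have [_ [[x _ <-] Px]] := closure_range_to_stone_cech Pp.
  have [_ [[y _ <-] Qy]] := closure_range_to_stone_cech Qq.
  by exists (x, y); exact: (PQ (_, _)).
- by move=> [x y] /U'W [/= A'x B'y]; apply: ABW; split=> /=; [exact: A'A|exact: B'B].
- move=> _ [[x y] Uxy <-]; apply: NO; rewrite /= -mE.
  by apply: U'O; exists (io (x, y)).
Qed.

Theorem theorem7 (R : realType) (G : semitopologicalGroupType)
    (tychG : tychonoff_space G) (pscG : pseudocompact R G) :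
  [<-> is_topological_group (@monoid.mul G) (@monoid.one G) (@monoid.inv G);
       exists m' : stone_cech R G -> stone_cech R G -> stone_cech R G,
         extends_to_stone_cech (@monoid.mul G) m' /\ separately_continuous m';
       exists m' : stone_cech R G -> stone_cech R G -> stone_cech R G,
         [/\ extends_to_stone_cech (@monoid.mul G) m',
             separately_continuous m' &
             exists (e : stone_cech R G) (i : stone_cech R G -> stone_cech R G),
               is_topological_group m' e i];
       quasi_continuous (fun p : G * G => monoid.mul p.1 p.2)].
Proof.
have fcG := pseudocompact_feebly_compact tychG.1 pscG.
have regG := @completely_regular_regular R G tychG.1.
have group3 : is_topological_group (@monoid.mul G) (@monoid.one G) (@monoid.inv G) ->
    exists m' : stone_cech R G -> stone_cech R G -> stone_cech R G,
    [/\ extends_to_stone_cech (@monoid.mul G) m', separately_continuous m' &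
      exists e i, is_topological_group m' e i].
  by move=> [_ _ _ cM cV]; exact: pseudocompact_stone_cech_group.
tfae.
- by move=> /group3[m [mE sm _]]; exists m.
(* (2) => (3) passes through (4) and (1), which supply a new, jointly continuous extension. *)
- move=> [m [mE sm]]; apply/group3/quasi_continuous_topological_group => //.
  exact: extension_quasi_continuous mE sm.
- by move=> [m [mE sm _]]; exact: extension_quasi_continuous mE sm.
- exact: quasi_continuous_topological_group.
Qed.
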